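(* Let $\mathcal Z$ be a finite concept set, $m\ge 1$, and fix a training pair $(\boldsymbol x,y)$ with $\boldsymbol x=(x_1,\dots,x_m)$. Let $\boldsymbol s(\boldsymbol x,y)\subseteq\mathcal Z^m$ be its (nonempty) set of valid candidates, let $w_\theta(\cdot\mid\boldsymbol x,y)$ be a probability distribution on $\boldsymbol s(\boldsymbol x,y)$ (the model-induced distribution), and let $P^\star(\cdot\mid\boldsymbol x,y)$ be a probability distribution on $\boldsymbol s(\boldsymbol x,y)$ (the true distribution over valid candidates). Then for any set $R\subseteq\boldsymbol s(\boldsymbol x,y)$ with $M_\theta(R;\boldsymbol x,y)>0$, $$ \mathcal R^\star(R;\boldsymbol x,y)\;\le\;\mathrm U_\theta(R;\boldsymbol x,y)+\mathrm{TV}\bigl(P^\star(\cdot\mid\boldsymbol x,y),\,w_\theta(\cdot\mid\boldsymbol x,y)\bigr)+1-M_\theta(R;\boldsymbol x,y), $$ where $M_\theta(R;\boldsymbol x,y)$ is the retained mass, $\mathrm U_\theta(R;\boldsymbol x,y)$ the retained uncertainty, $\mathcal R^\star(R;\boldsymbol x,y)$ the ideal risk of the retained prediction, and $\mathrm{TV}$ the total variation distance.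
   Context: Setting: $\mathcal X$ is an input space, $\mathcal Z$ a finite set of concepts, $\mathcal Y$ a target space; $\boldsymbol x=(x_j)_{j=1}^m\in\mathcal X^m$ and $y\in\mathcal Y$. Given background knowledge $\mathrm{KB}$, the set of valid candidates is $\boldsymbol s(\boldsymbol x,y)=\{\boldsymbol c\in\mathcal Z^m:\boldsymbol c\wedge\mathrm{KB}\models y\}$, i.e. the concept assignments $\boldsymbol c=(c_1,\dots,c_m)$ that together with $\mathrm{KB}$ entail $y$; it is assumed nonempty. The weights $w_\theta(\boldsymbol c\mid\boldsymbol x,y)$ form an arbitrary normalized distribution over $\boldsymbol s(\boldsymbol x,y)$ determined by a model with parameters $\theta$. Definitions, for $R\subseteq\boldsymbol s(\boldsymbol x,y)$: - Retained mass: $M_\theta(R;\boldsymbol x,y)=\sum_{\boldsymbol c\in R}w_\theta(\boldsymbol c\mid\boldsymbol x,y)$. When $M_\theta(R;\boldsymbol x,y)>0$: - Retained conditional distribution: $q_{\theta,R}(\boldsymbol c\mid\boldsymbol x,y)=\dfrac{w_\theta(\boldsymbol c\mid\boldsymbol x,y)}{M_\theta(R;\boldsymbol x,y)}\,\mathbb I[\boldsymbol c\in R]$, where $\mathbb I$ denotes the indicator. - Marginal at position $j\in\{1,\dots,m\}$: $\pi_{\theta,R,j}(k)=\Pr_{\boldsymbol c\sim q_{\theta,R}(\cdot\mid\boldsymbol x,y)}(c_j=k)$ for $k\in\mathcal Z$. - Retained uncertainty: $\mathrm U_\theta(R;\boldsymbol x,y)=\frac1m\sum_{j=1}^m\bigl(1-\max_{k\in\mathcal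 Z}\pi_{\theta,R,j}(k)\bigr)$. - Retained prediction at position $j$: $\hat z_{R,j}(\boldsymbol x,y)\in\arg\max_{k\in\mathcal Z}\pi_{\theta,R,j}(k)$ (any choice of maximizer). - Ideal risk: $\mathcal R^\star(R;\boldsymbol x,y)=\mathbb E_{\boldsymbol c\sim P^\star(\cdot\mid\boldsymbol x,y)}\Bigl[\frac1m\sum_{j=1}^m\mathbb I[\hat z_{R,j}(\boldsymbol x,y)\neq c_j]\Bigr]$. - Total variation distance between distributions $P,Q$ on the finite set $\boldsymbol s(\boldsymbol x,y)$: $\mathrm{TV}(P,Q)=\frac12\sum_{\boldsymbol c\in\boldsymbol s(\boldsymbol x,y)}|P(\boldsymbol c)-Q(\boldsymbol c)|$. *)

(* Defs.v *)
From mathcomp Require Import all_boot all_order all_algebra.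

Set Implicit Arguments.
Unset Strict Implicit.
Unset Printing Implicit Defensive.

Import Order.TTheory GRing.Theory Num.Theory.
Local Open Scope ring_scope.

(* Assignments c = (c_1, ..., c_m) in Z^m; positions are numbered from 0. *)
Definition assignment (Z : finType) (m : nat) : finType := {ffun 'I_m -> Z}.

(* The logic is left abstract: [entails kb c y] stands for c /\ kb |= y. *)
Definition valid_candidates (Z : finType) (m : nat) (Y KBase : Type)
    (entails : KBase -> assignment Z m -> Y -> bool) (kb : KBase) (y : Y) :
    {set assignment Z m} :=
  [set c | entails kb c y].

(* A distribution on S is represented by its mass function on the whole type,
   extended by 0 outside S. *)
Definition distribution_on (F : realFieldType) (T : finType) (S : {set T})
    (p : T -> F) : Prop :=
  [/\ forall c, 0 <= p c,
      forall c, c \notin S -> p c = 0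
    & \sum_(c in S) p c = 1].

Definition probability (F : realFieldType) (T : finType) (p : T -> F)
    (E : pred T) : F :=
  \sum_(c | E c) p c.

Definition expectation (F : realFieldType) (T : finType) (p f : T -> F) : F :=
  \sum_c p c * f c.

Definition total_variation (F : realFieldType) (T : finType) (S : {set T})
    (p q : T -> F) : F :=
  2^-1 * \sum_(c in S) `|p c - q c|.

Definition retained_mass (F : realFieldType) (T : finType) (w : T -> F)
    (R : {set T}) : F :=
  \sum_(c in R) w c.

(* Meaningful only when the retained mass is positive. *)
Definition retained_conditional (F : realFieldType) (T : finType) (w : T -> F)
    (R : {set T}) (c : T) : F :=
  w c / retained_mass w R * (c \in R)%:R.

Definition retained_marginal (F : realFieldType) (Z : finType) (m : nat)
    (w : assignment Z m -> F) (R : {set assignment Z m}) (j : 'I_m) (k : Z) : F :=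
  probability (retained_conditional w R) (fun c => c j == k).

(* The default value 0 of the iterated maximum is harmless: marginals are
   nonnegative and Z is nonempty as soon as 0 < m and an assignment exists. *)
Definition retained_uncertainty (F : realFieldType) (Z : finType) (m : nat)
    (w : assignment Z m -> F) (R : {set assignment Z m}) : F :=
  m%:R^-1 *
    \sum_(j < m) (1 - \big[Num.max/0]_(k : Z) retained_marginal w R j k).

Definition is_argmax (F : realFieldType) (Z : finType) (f : Z -> F) (k : Z) :
    Prop :=
  forall k', f k' <= f k.

Definition retained_prediction (F : realFieldType) (Z : finType) (m : nat)
    (w : assignment Z m -> F) (R : {set assignment Z m}) (zhat : 'I_m -> Z) :
    Prop :=
  forall j, is_argmax (retained_marginal w R j) (zhat j).

Definition ideal_risk (F : realFieldType) (Z : finType) (m : nat)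
    (pstar : assignment Z m -> F) (zhat : 'I_m -> Z) : F :=
  expectation pstar (fun c => m%:R^-1 * \sum_(j < m) (zhat j != c j)%:R).

(* Main.v *)
(* Write f for the normalized Hamming loss of the retained prediction, w for the
   model distribution, q for its conditioning on R and M for the retained mass.
   As 0 <= f <= 1, replacing the true distribution by w changes the mean of f by
   at most the total variation distance, and replacing w by q lowers it by at most
   1 - M, since w = M q <= q on R while w has mass 1 - M off R. Under q the mean of f
   is the retained uncertainty, by linearity. *)
Require Import Defs.
From mathcomp Require Import all_boot all_order all_algebra.
From mathcomp Require Import lra.
Import Order.TTheory GRing.Theory Num.Theory.
Local Open Scope ring_scope.

Lemma sum_distribution (F : realFieldType) (T : finType) (S : {set T})
    (p : T -> F) : distribution_on S p -> \sum_c p c = 1.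
Proof.
by case=> _ pS0 <-; rewrite (bigID (mem S)) /= [X in _ + X]big1 ?addr0.
Qed.

Lemma expectation_total_variation (F : realFieldType) (T : finType)
    (S : {set T}) (p q f : T -> F) :
  distribution_on S p -> distribution_on S q -> (forall c, 0 <= f c <= 1) ->
  expectation p f <= expectation q f + total_variation S p q.
Proof.
move=> p_dist q_dist f01.
have [[_ pS0 _] [_ qS0 _]] := (p_dist, q_dist).
(* p and q have the same mass, so f can be centred to take values in
   [-1/2, 1/2]; this is what saves the factor 2. *)
have -> : expectation p f =
    expectation q f + \sum_c (p c - q c) * (f c - 2^-1).
  apply/eqP; rewrite addrC -subr_eq -sumrB -subr_eq0 -sumrB; apply/eqP.
  rewrite (eq_bigr (fun c => 2^-1 * (p c - q c))); last by move=> c _; lra.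
  rewrite -mulr_sumr sumrB (sum_distribution _ _ _ _ p_dist).
  by rewrite (sum_distribution _ _ _ _ q_dist) subrr mulr0.
(* Both mass functions vanish off [S], so only the terms counted by [total_variation] remain. *)
rewrite lerD2l (bigID (mem S)) /= [X in _ + X]big1 ?addr0; last first.
  by move=> c cS; rewrite pS0 ?qS0 // subrr mul0r.
rewrite /total_variation mulr_sumr; apply: ler_sum => c _.
apply: le_trans (ler_norm _) _; rewrite normrM mulrC ler_wpM2r //.
by rewrite ler_norml; have /andP[? ?] := f01 c; lra.
Qed.

Lemma sum_retained_conditional (F : realFieldType) (T : finType) (w : T -> F)
    (R : {set T}) :
  0 < retained_mass w R -> \sum_c retained_conditional w R c = 1.
Proof.
move=> M_gt0; rewrite (bigID (mem R)) /= [X in _ + X]big1 ?addr0; last first.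
  by move=> c /negPf cR; rewrite /retained_conditional cR mulr0.
rewrite (eq_bigr (fun c => w c / retained_mass w R)); last first.
  by move=> c cR; rewrite /retained_conditional cR mulr1.
by rewrite -mulr_suml divff // gt_eqF.
Qed.

Lemma expectation_retained_conditional (F : realFieldType) (T : finType)
    (S R : {set T}) (w f : T -> F) :
  distribution_on S w -> 0 < retained_mass w R ->
  (forall c, 0 <= f c <= 1) ->
  expectation w f <=
    expectation (retained_conditional w R) f + (1 - retained_mass w R).
Proof.
move=> w_dist M_gt0 f01; have [w_ge0 _ _] := w_dist.
have sum_w : retained_mass w R + \sum_(c in ~: R) w c = 1.
  rewrite -(sum_distribution _ _ _ _ w_dist) [RHS](bigID (mem R)) /=.
  by congr (_ + _); apply: eq_bigl => c; rewrite inE.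
have off_R_ge0 : 0 <= \sum_(c in ~: R) w c by apply: sumr_ge0.
(* Writing the lost mass as a sum over the complement of [R] reduces the claim to a comparison of
   individual terms. *)
have -> : 1 - retained_mass w R = \sum_(c in ~: R) w c by lra.
rewrite /expectation [X in _ + X]big_mkcond -big_split; apply: ler_sum => c _ /=.
have /andP[f_ge0 f_le1] := f01 c; rewrite /retained_conditional inE.
(* Off [R] the conditional is 0 and [w c * f c <= w c]; on [R], dividing [w c] by the retained mass
   cannot decrease it, that mass being at most 1 by [sum_w] and [off_R_ge0]. *)
case: (c \in R) => /=; last by rewrite mulr0 mul0r add0r ler_piMr.
rewrite mulr1 addr0 ler_wpM2r // ler_peMr // invf_ge1 //; lra.
Qed.

Lemma hamming_loss_itv (F : realFieldType) (Z : finType) (m : nat)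
    (zhat : 'I_m -> Z) (c : assignment Z m) :
  0 <= (m%:R^-1 * \sum_(j < m) (zhat j != c j)%:R : F) <= 1.
Proof.
have loss_ge0 : 0 <= \sum_(j < m) (zhat j != c j)%:R :> F.
  by apply: sumr_ge0 => j _; rewrite ler0n.
(* For [m = 0] the convention [0^-1 = 0] makes the loss 0. *)
have [m0|m_gt0] := posnP m.
  by rewrite [X in X%:R^-1]m0 invr0 mul0r lexx ler01.
rewrite mulr_ge0 ?invr_ge0 ?ler0n //= mulrC ler_pdivrMr ?ltr0n // mul1r.
rewrite -natr_sum ler_nat -[leqRHS]card_ord -sum1_card.
by apply: leq_sum => j _; apply: leq_b1.
Qed.

(** Linearity of expectation: after exchanging the sums, position [j] contributes the mass of
    disagreement, which is the total mass 1 minus the mass of agreement. *)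
Lemma expectation_hamming_loss (F : realFieldType) (Z : finType) (m : nat)
    (p : assignment Z m -> F) (zhat : 'I_m -> Z) :
  \sum_c p c = 1 ->
  ideal_risk p zhat =
    m%:R^-1 * \sum_(j < m) (1 - probability p (fun c => c j == zhat j)).
Proof.
move=> sum_p; rewrite /ideal_risk /expectation.
under eq_bigr => c _ do rewrite mulrCA mulr_sumr.
rewrite -mulr_sumr exchange_big /=; congr (_ * _); apply: eq_bigr => j _.
rewrite -[X in X - _]sum_p /probability [X in _ - X]big_mkcond -sumrB.
apply: eq_bigr => c _; rewrite eq_sym.
by case: eqP => _ /=; rewrite ?mulr0 ?mulr1 ?subrr ?subr0.
Qed.

Lemma ideal_risk_retained_conditional (F : realFieldType) (Z : finType)
    (m : nat) (w : assignment Z m -> F) (R : {set assignment Z m})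
    (zhat : 'I_m -> Z) :
  (forall c, 0 <= w c) -> 0 < retained_mass w R ->
  retained_prediction w R zhat ->
  ideal_risk (retained_conditional w R) zhat <= retained_uncertainty w R.
Proof.
move=> w_ge0 M_gt0 zhat_pred.
rewrite expectation_hamming_loss ?sum_retained_conditional //.
rewrite ler_wpM2l ?invr_ge0 ?ler0n //; apply: ler_sum => j _.
(* It remains to bound the iterated maximum by the marginal at [zhat j]: its default value 0 is
   below because marginals are nonnegative, and each entry is below because [zhat j] is a
   maximizer. *)
rewrite lerD2l lerN2; apply: (big_ind (fun u => u <= _)) => [|u v u_le v_le|k _].
- apply: sumr_ge0 => c _.
  by rewrite mulr_ge0 ?ler0n // divr_ge0 ?w_ge0 // ltW.
- by rewrite ge_max u_le.
- exact: zhat_pred.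
Qed.

Theorem theorem1 (F : realFieldType) (X Y KBase Theta : Type) (Z : finType)
    (m : nat) (m_gt0 : (0 < m)%N)
    (entails : KBase -> assignment Z m -> Y -> bool) (kb : KBase)
    (x : 'I_m -> X) (y : Y)
    (s_neq0 : valid_candidates entails kb y != set0)
    (w : Theta -> ('I_m -> X) -> Y -> assignment Z m -> F) (theta : Theta)
    (w_dist : distribution_on (valid_candidates entails kb y) (w theta x y))
    (pstar : ('I_m -> X) -> Y -> assignment Z m -> F)
    (pstar_dist : distribution_on (valid_candidates entails kb y) (pstar x y))
    (R : {set assignment Z m})
    (R_sub : R \subset valid_candidates entails kb y)
    (R_mass : 0 < retained_mass (w theta x y) R)
    (zhat : 'I_m -> Z)
    (zhat_pred : retained_prediction (w theta x y) R zhat) :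
  ideal_risk (pstar x y) zhat <=
    retained_uncertainty (w theta x y) R
    + total_variation (valid_candidates entails kb y)
        (pstar x y) (w theta x y)
    + 1 - retained_mass (w theta x y) R.
Proof.
have [w_ge0 _ _] := w_dist.
have f01 := hamming_loss_itv F Z m zhat.
have := expectation_total_variation _ _ _ _ _ _ pstar_dist w_dist f01.
have := expectation_retained_conditional _ _ _ _ _ _ w_dist R_mass f01.
have := ideal_risk_retained_conditional _ _ _ _ _ _ w_ge0 R_mass zhat_pred.
(* Unfolding exposes the expectations under [pstar], [w] and the conditional, through which the
   three bounds chain. *)
rewrite /ideal_risk; lra.
Qed.
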